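(* There exist a class $\mathcal{C}$ of $2$-generated residually finite groups and a function $f_0 : \mathbb{N} \rightarrow \mathbb{N}$ satisfying the following: (i) for all $f : \mathbb{N} \rightarrow \mathbb{N}$ there exists $B_f \in \mathcal{C}$ such that $f \preceq \mathcal{R}_{B_f}$; (ii) for all $\Gamma \in \mathcal{C}$, $\mathcal{L}_{\Gamma} \preceq f_0$; (iii) $f_0(n) \preceq \exp(\exp(n))$.
   Context: $\mathbb{N}=\{1,2,\ldots\}$. For groups $\Gamma,\Delta$ and $F\subseteq\Gamma$, a partial homomorphism of $F$ into $\Delta$ is a function $\pi:F\to\Delta$ such that for all $g,h\in F$, if $gh\in F$ then $\pi(gh)=\pi(g)\pi(h)$. It is a local embedding if moreover it is injective. For a group $\Gamma$ generated by a finite set $S$, let $B_S(n)$ be the closed ball of radius $n$ around the identity in the word metric of $S$. LEF growth: $\mathcal{L}_\Gamma^S(n)=\min\{|Q| : Q$ a finite group for which there is a local embedding $B_S(n)\to Q\}$ ($\infty$ if there is none). Full residual finiteness growth: for $\Gamma$ residually finite, $\mathcal{R}_\Gamma^S(n)=\min\{|F| : F$ a finite group for which there is a homomorphism $\pi:\Gamma\to F$ with $\pi|_{B_S(n)}$ injective$\}$. Comparison: for functions $f_1,f_2$ from $\mathbb{N}$ to $(0,\infty)$, $f_1\preceq f_2$ means that there is a constant $C>0$ with $f_1(n)\le f_2(Cn)$ for all $n\in\mathbb{N}$, where functions on $\mathbb{N}$ are evaluated at real $x>0$ by $f(x)=f(\lceil x\rceil)$. Up to the equivalence ($f_1\preceq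 f_2$ and $f_2\preceq f_1$) the functions $\mathcal{L}_\Gamma^S$ and $\mathcal{R}_\Gamma^S$ do not depend on the finite generating set $S$, and one writes $\mathcal{L}_\Gamma$, $\mathcal{R}_\Gamma$. *)

(* Defs.v *)
From HB Require Import structures.
From mathcomp Require Import all_boot all_order all_algebra all_fingroup.
From mathcomp Require Import mathcomp_extra boolp classical_sets functions.
From mathcomp Require Import cardinality reals ereal sequences exp.

Set Implicit Arguments.
Unset Strict Implicit.
Unset Printing Implicit Defensive.

Import Order.TTheory GRing.Theory Num.Theory.

Local Open Scope classical_set_scope.
Local Open Scope ring_scope.

Definition word_ball (G : groupType) (S : set G) (n : nat) : set G :=
  [set g | exists w : seq G,
     [/\ (size w <= n)%N,
         forall x, x \in w -> S x \/ S (x^-1)%g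
       & g = (\prod_(x <- w) x)%g]].

Definition generated_by (G : groupType) (S : set G) : Prop :=
  forall g : G, exists n : nat, word_ball S n g.

Definition two_generated (G : groupType) : Prop :=
  exists a b : G, generated_by [set a; b].

(* A map defined only on [F] is represented by a total map [pi] whose values
   outside [F] are irrelevant, as they are never constrained. *)
Definition partial_hom (G D : groupType) (F : set G) (pi : G -> D) : Prop :=
  forall g h : G, F g -> F h -> F (g * h)%g -> pi (g * h)%g = (pi g * pi h)%g.

Definition local_embedding (G D : groupType) (F : set G) (pi : G -> D) : Prop :=
  partial_hom F pi /\ set_inj F pi.

Definition group_hom (G D : groupType) (pi : G -> D) : Prop :=
  {morph pi : x y / (x * y)%g >-> (x * y)%g}.

Definition residually_finite (G : groupType) : Prop :=
  forall g : G, g <> 1%g ->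
    exists (F : finGroupType) (pi : G -> F), group_hom pi /\ pi g <> 1%g.

(* As an infimum of natural numbers this is a minimum, attained when some [Q]
   satisfies [P] (lemma [min_order_attained]), and it is [+oo] otherwise. *)
Definition min_order (R : realType) (P : finGroupType -> Prop) : \bar R :=
  ereal_inf [set (n%:R)%:E | n in
    [set n : nat | exists Q : finGroupType, P Q /\ #|Q| = n]].

Lemma min_order_attained (R : realType) (P : finGroupType -> Prop) :
  (exists Q, P Q) ->
  exists Q : finGroupType, [/\ P Q, min_order R P = (#|Q|%:R)%:E
    & forall Q' : finGroupType, P Q' -> (#|Q| <= #|Q'|)%N].
Proof.
move=> [Q0 PQ0].
have ex : exists n, `[< exists Q : finGroupType, P Q /\ #|Q| = n >].
  by exists #|Q0|; apply/asboolP; exists Q0.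
case: (ex_minnP ex) => m /asboolP[Q [PQ Qm]] minm.
have le Q' : P Q' -> (#|Q| <= #|Q'|)%N.
  by move=> PQ'; rewrite Qm; apply: minm; apply/asboolP; exists Q'.
exists Q; split => //; apply/eqP; rewrite eq_le; apply/andP; split.
  by apply: ereal_inf_lbound; exists #|Q| => //; exists Q.
apply: le_ereal_inf_tmp => _ [_ [Q' [PQ' <-]] <-].
by rewrite lee_fin ler_nat le.
Qed.

Definition lef_growth (R : realType) (G : groupType) (S : set G) (n : nat) :
    \bar R :=
  min_order R (fun Q => exists pi : G -> Q, local_embedding (word_ball S n) pi).

Definition rf_growth (R : realType) (G : groupType) (S : set G) (n : nat) :
    \bar R :=
  min_order R (fun Q => exists pi : G -> Q,
    group_hom pi /\ set_inj (word_ball S n) pi).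

Definition eval_at (R : realType) (f : nat -> \bar R) (x : R) : \bar R :=
  f `|Num.ceil x|%N.

(* Growth functions live on the positive integers: the value at [0] plays no
   role.  Extended real values accommodate [lef_growth] and [rf_growth]. *)
Definition preceq (R : realType) (f1 f2 : nat -> \bar R) : Prop :=
  exists2 c : R, 0 < c &
    forall n : nat, (0 < n)%N -> (f1 n <= eval_at f2 (c * n%:R))%E.

Definition pos_fun (f : nat -> nat) : Prop :=
  forall n : nat, (0 < n)%N -> (0 < f n)%N.

Definition of_natfun (R : realType) (f : nat -> nat) (n : nat) : \bar R :=
  ((f n)%:R)%:E.

Definition expexp (R : realType) (n : nat) : \bar R :=
  (expR (expR n%:R))%:E.

(* The growth functions attached to two finite generating sets of a group are
   [preceq]-equivalent, so that a comparison involving the growth of the group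
   is required for each of its finite generating sets. *)
Definition preceq_rf_growth (R : realType) (f : nat -> \bar R)
    (G : groupType) : Prop :=
  forall S : set G, finite_set S -> generated_by S ->
    preceq f (@rf_growth R G S).

Definition lef_growth_preceq (R : realType) (G : groupType)
    (f : nat -> \bar R) : Prop :=
  forall S : set G, finite_set S -> generated_by S ->
    preceq (@lef_growth R G S) f.

(* Main.v *)
Require Import Defs.
From HB Require Import structures.
From mathcomp Require Import all_boot all_order all_algebra all_fingroup.
From mathcomp Require Import cyclic ring zify.
From mathcomp Require Import boolp classical_sets cardinality.
From mathcomp Require Import reals ereal sequences exp.

(** For each [i] let [T_i] be the lamplighter-like group, central by metabelian,
    with lamps in [Z/p_i] sitting on the cycle [Z/4^(i+1)], in which two lamps
    commute up to a central element of [Z/p_i] that is nontrivial exactly when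
    they are at distance [4^i].  The group [Gamma] is generated by the lamp [x]
    and the step [t] in the product of all the [T_i].

    The commutator of [x] and [t^(4^i) x t^(-4^i)] has length [O(4^i)], lives in
    the coordinate [i] only and has prime order [p_i]; a finite quotient that
    detects it has at least [p_i] elements, and [p_i] is as large as we like.

    On the other hand, whether a word of length [m] is trivial in [T_i] is
    expressed by congruences modulo [p_i] between integers of size at most
    [m^2], so that [p_i] may be replaced by [min (p_i, m^2 + 2)] without any
    effect on such words; and the coordinates [i > m] follow from the
    coordinate [m].  So balls embed locally into a finite group whose order is
    at most doubly exponential, uniformly in the [p_i]. *)

Set Implicit Arguments.
Unset Strict Implicit.
Unset Printing Implicit Defensive.

Import Order.TTheory GRing.Theory Num.Theory.

Local Open Scope ring_scope.

(** * Central extensions of finite lamplighter groups *)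

Section TwistedLamplighter.
Variables (A : finNzRingType) (K : finComNzRingType) (h : A).

(* The unused argument is the offset [h], from which the group law of
   [twisted h] is inferred. *)
Definition twisted of A : Type := (A * {ffun A -> K} * K)%type.
HB.instance Definition _ :=
  Finite.copy (twisted h) (A * {ffun A -> K} * K)%type.

Implicit Types (u v w : {ffun A -> K}) (f g : twisted h).

Definition shift (s : A) u : {ffun A -> K} := [ffun a => u (a - s)].

(** The 2-cocycle of the central extension. It is bilinear but in general not symmetric; its
    antisymmetrization gives the commutators of lamp configurations. *)
Definition pairing u v : K := \sum_a u a * v (a + h).

Lemma shiftD s t u : shift (s + t) u = shift s (shift t u).
Proof. by apply/ffunP => a; rewrite !ffunE opprD addrA. Qed.

Lemma shift0 u : shift 0 u = u.
Proof. by apply/ffunP => a; rewrite ffunE subr0. Qed.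

Lemma shift_add s u v : shift s (u + v) = shift s u + shift s v.
Proof. by apply/ffunP => a; rewrite !ffunE. Qed.

Lemma shift_opp s u : shift s (- u) = - shift s u.
Proof. by apply/ffunP => a; rewrite !ffunE. Qed.

Lemma shift_zero s : shift s 0 = 0.
Proof. by apply/ffunP => a; rewrite !ffunE. Qed.

Lemma pairingDl u v w : pairing (u + v) w = pairing u w + pairing v w.
Proof. by rewrite -big_split; apply: eq_bigr => a _; rewrite ffunE mulrDl. Qed.

Lemma pairingDr u v w : pairing w (u + v) = pairing w u + pairing w v.
Proof. by rewrite -big_split; apply: eq_bigr => a _; rewrite ffunE mulrDr. Qed.

Lemma pairing0l u : pairing 0 u = 0.
Proof. by apply: big1 => a _; rewrite ffunE mul0r. Qed.

Lemma pairing0r u : pairing u 0 = 0.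
Proof. by apply: big1 => a _; rewrite ffunE mulr0. Qed.

Lemma pairingNl u v : pairing (- u) v = - pairing u v.
Proof. by apply/eqP; rewrite -addr_eq0 -pairingDl addNr pairing0l. Qed.

(** Reindexing by [a + s] gives this invariance, which makes [twisted_mul] associative. *)
Lemma pairing_shift s u v : pairing (shift s u) (shift s v) = pairing u v.
Proof.
rewrite /pairing (reindex_inj (addIr s)) /=; apply: eq_bigr => a _.
by rewrite !ffunE addrK [a + s + h]addrAC addrK.
Qed.

Definition twisted_mul f g : twisted h :=
  (f.1.1 + g.1.1, f.1.2 + shift f.1.1 g.1.2,
   f.2 + g.2 + pairing f.1.2 (shift f.1.1 g.1.2)).

Definition twisted_one : twisted h := (0, 0, 0).

Definition twisted_inv f : twisted h :=
  (- f.1.1, - shift (- f.1.1) f.1.2, - f.2 + pairing f.1.2 f.1.2).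

Lemma twisted_mulA : associative twisted_mul.
Proof.
move=> [[r u] x] [[s v] y] [[t w] z]; rewrite /twisted_mul /=.
congr (_, _, _); first by rewrite addrA.
  by rewrite shift_add -shiftD addrA.
rewrite shift_add -shiftD pairingDr pairingDl shiftD pairing_shift -shiftD.
ring.
Qed.

Lemma twisted_mul1 : left_id twisted_one twisted_mul.
Proof.
by move=> [[s u] x]; rewrite /twisted_mul /= !add0r shift0 pairing0l addr0.
Qed.

Lemma twisted_mulV : left_inverse twisted_one twisted_inv twisted_mul.
Proof.
move=> [[s u] x]; rewrite /twisted_mul /twisted_inv /twisted_one /=.
rewrite !addNr; congr (_, _, _).
by rewrite pairingNl pairing_shift; ring.
Qed.

HB.instance Definition _ :=
  Finite_isGroup.Build (twisted h) twisted_mulA twisted_mul1 twisted_mulV.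

Definition delta (a : A) : {ffun A -> K} := [ffun b => (b == a)%:R].

Definition height f : A := f.1.1.
Definition lights f : {ffun A -> K} := f.1.2.
Definition central f : K := f.2.

Lemma heightM f g : height (f * g)%g = height f + height g.
Proof. by []. Qed.

Lemma lightsM f g : lights (f * g)%g = lights f + shift (height f) (lights g).
Proof. by []. Qed.

Lemma centralM f g : central (f * g)%g =
  central f + central g + pairing (lights f) (shift (height f) (lights g)).
Proof. by []. Qed.

Lemma heightV f : height f^-1%g = - height f.
Proof. by []. Qed.

Lemma lightsV f : lights f^-1%g = - shift (- height f) (lights f).
Proof. by []. Qed.

Lemma centralV f : central f^-1%g = - central f + pairing (lights f) (lights f).
Proof. by []. Qed.

Lemma twisted_eq1 f :
  f = 1%g <-> [/\ height f = 0, lights f = 0 & central f = 0].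
Proof.
split=> [->//|]; rewrite /height /lights /central.
by case: f => -[s u] z /= [-> -> ->].
Qed.

Lemma pairing_delta a u : pairing (delta a) u = u (a + h).
Proof.
rewrite /pairing (bigD1 a) //= big1 ?addr0 => [|b /negPf ba].
  by rewrite ffunE eqxx mul1r.
by rewrite ffunE ba mul0r.
Qed.

Definition lamp : twisted h := (0, delta 0, 0).
Definition step : twisted h := (1, 0, 0).

End TwistedLamplighter.

(** * Products of arbitrary families of groups *)

Section ProductGroup.
Variables (I : Type) (G : I -> groupType).

Definition product_group : Type := forall i, G i.

HB.instance Definition _ := gen_eqMixin product_group.
HB.instance Definition _ := gen_choiceMixin product_group.

Implicit Types f g : product_group.

Definition product_mul f g : product_group := fun i => (f i * g i)%g.
Definition product_one : product_group := fun i => 1%g.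
Definition product_inv f : product_group := fun i => (f i)^-1%g.

Lemma product_mulA : associative product_mul.
Proof.
move=> f g k; apply/functional_extensionality_dep => i; exact: mulgA.
Qed.

Lemma product_mul1 : left_id product_one product_mul.
Proof.
move=> f; apply/functional_extensionality_dep => i; exact: mul1g.
Qed.

Lemma product_mulr1 : right_id product_one product_mul.
Proof.
move=> f; apply/functional_extensionality_dep => i; exact: mulg1.
Qed.

Lemma product_mulV : left_inverse product_one product_inv product_mul.
Proof.
move=> f; apply/functional_extensionality_dep => i; exact: mulVg.
Qed.

Lemma product_mulrV : right_inverse product_one product_inv product_mul.
Proof.
move=> f; apply/functional_extensionality_dep => i; exact: mulgV.
Qed.

HB.instance Definition _ := isGroup.Build product_group product_mulA
  product_mul1 product_mulr1 product_mulV product_mulrV.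

End ProductGroup.

(** * Calculus of word balls *)

Section WordBall.
Variables (G : groupType) (S : set G).

Lemma word_ballM m n g h :
  word_ball S m g -> word_ball S n h -> word_ball S (m + n) (g * h)%g.
Proof.
move=> [u [su uS ->]] [v [sv vS ->]]; exists (u ++ v); split.
- by rewrite size_cat leq_add.
- by move=> x; rewrite mem_cat => /orP[/uS|/vS].
- by rewrite big_cat.
Qed.

Lemma word_ball_le m n g : (m <= n)%N -> word_ball S m g -> word_ball S n g.
Proof.
by move=> mn [u [su uS ->]]; exists u; split => //; apply: leq_trans mn.
Qed.

Lemma word_ball1 n : word_ball S n 1%g.
Proof. by exists [::]; split => //; rewrite big_nil. Qed.

Lemma word_ballV n g : word_ball S n g -> word_ball S n (g^-1)%g.
Proof.
move=> [u [su uS ->]]; exists (rev [seq x^-1%g | x <- u]); split.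
- by rewrite size_rev size_map.
- move=> x; rewrite mem_rev => /mapP[y /uS Sy ->]; rewrite invgK.
  by case: Sy => Sy; [right|left].
- by rewrite -map_rev big_map prodgV revK.
Qed.

Lemma word_ball_gen g : S g -> word_ball S 1 g.
Proof.
move=> Sg; exists [:: g]; split => //; last by rewrite big_seq1.
by move=> x; rewrite inE => /eqP ->; left.
Qed.

Lemma word_ballX n g k : word_ball S n g -> word_ball S (k * n) (g ^+ k)%g.
Proof.
move=> Bg; elim: k => [|k IH]; first exact: word_ball1.
by rewrite expgS mulSn; apply: word_ballM.
Qed.

End WordBall.

Lemma word_ball_sub (G : groupType) (S T : set G) c n g :
  (forall x, S x -> word_ball T c x) ->
  word_ball S n g -> word_ball T (c * n) g.
Proof.
move=> ST [u [su uS ->]].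
suff: word_ball T (size u * c) (\prod_(x <- u) x)%g.
  by apply: word_ball_le; rewrite mulnC leq_mul2l su orbT.
elim: u {su} uS => [|x u IH] uS; first by rewrite big_nil; exact: word_ball1.
rewrite big_cons mulSn; apply: word_ballM; last first.
  by apply: IH => y yu; apply: uS; rewrite inE yu orbT.
case: (uS x (mem_head _ _)) => /ST // /word_ballV; by rewrite invgK.
Qed.

(** * Spanned subgroups and words in two letters *)

Section Span.
Variables (G : groupType) (S : set G).

Definition spanned : pred G := fun g => `[< exists n, word_ball S n g >].

Lemma spanned_closed : group_closed spanned.
Proof.
split; first by apply/asboolP; exists 0%N; exact: word_ball1.
move=> g h /asboolP[m Bg] /asboolP[n Bh]; apply/asboolP.
by exists (m + n)%N; apply: word_ballM => //; apply: word_ballV.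
Qed.

Definition span_group : Type := {g : G | spanned g}.
HB.instance Definition _ := [isSub for (@sval _ _ : span_group -> G)].
HB.instance Definition _ := [Choice of span_group by <:].
HB.instance Definition _ :=
  SubChoice_isSubGroup.Build G spanned span_group spanned_closed.

End Span.

(* The letter [(b, e)] is the first generator if [b] and the second one
   otherwise, inverted if [e]. *)
Definition word : Type := seq (bool * bool).

Definition word_inv (w : word) : word := rev [seq (l.1, ~~ l.2) | l <- w].

Section Eval.
Variables (G : groupType) (a b : G).

Definition word_eval_letter (l : bool * bool) : G :=
  let x := if l.1 then a else b in if l.2 then x^-1%g else x.

Definition word_eval (w : word) : G := (\prod_(l <- w) word_eval_letter l)%g.

Lemma word_eval_cons l w :
  word_eval (l :: w) = (word_eval_letter l * word_eval w)%g.
Proof. exact: big_cons. Qed.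

Lemma word_eval_cat v w : word_eval (v ++ w) = (word_eval v * word_eval w)%g.
Proof. exact: big_cat. Qed.

Lemma word_eval_inv w : word_eval (word_inv w) = (word_eval w)^-1%g.
Proof.
elim: w => [|l w IH]; first by rewrite /word_eval !big_nil invg1.
rewrite /word_inv map_cons rev_cons -cats1 word_eval_cat IH.
rewrite (word_eval_cons l) invgM.
congr (_ * _)%g; rewrite /word_eval big_seq1 /word_eval_letter.
by case: l => -[] [] /=; rewrite ?invgK.
Qed.

Lemma word_ballE n g : word_ball [set a; b] n g <->
  exists2 w : word, (size w <= n)%N & g = word_eval w.
Proof.
split=> [[u [su uS ->]]|[w sw ->]].
  suff [w sw ->] : exists2 w : word, size w = size u &
      (\prod_(x <- u) x)%g = word_eval w.
    by exists w; rewrite // sw.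
  elim: u {su} uS => [|x u IH] uS.
    by exists [::]; rewrite /word_eval ?big_nil.
  have [|w sw e] := IH; first by move=> y yu; apply: uS; rewrite inE yu orbT.
  have [l xl] : exists l, x = word_eval_letter l.
    have [[]|[]] := uS x (mem_head _ _) => xE.
    - by exists (true, false).
    - by exists (false, false).
    - by exists (true, true); rewrite /word_eval_letter /= -xE invgK.
    - by exists (false, true); rewrite /word_eval_letter /= -xE invgK.
  by exists (l :: w); rewrite /= ?sw // big_cons word_eval_cons e xl.
exists [seq word_eval_letter l | l <- w]; split; rewrite ?size_map ?big_map //.
move=> x /mapP[[[] []] _ ->]; rewrite /word_eval_letter /= ?invgK.
- by right; left.
- by left; left.
- by right; right.
- by left; right.
Qed.

End Eval.

(** * Homomorphisms, and local embeddings read off from words *)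

Lemma group_hom1 (G D : groupType) (f : G -> D) : group_hom f -> f 1%g = 1%g.
Proof. by move=> fM; apply: (@mulgI _ (f 1%g)); rewrite -fM !mulg1. Qed.

Lemma group_homV (G D : groupType) (f : G -> D) x :
  group_hom f -> f x^-1%g = (f x)^-1%g.
Proof.
by move=> fM; apply: (@mulgI _ (f x)); rewrite -fM !mulgV group_hom1.
Qed.

Lemma group_homX (G D : groupType) (f : G -> D) x n :
  group_hom f -> f (x ^+ n)%g = (f x ^+ n)%g.
Proof.
by move=> fM; elim: n => [|n IH]; rewrite ?group_hom1 // !expgS fM IH.
Qed.

Lemma word_eval_hom (G D : groupType) (f : G -> D) a b w :
  group_hom f -> f (word_eval a b w) = word_eval (f a) (f b) w.
Proof.
move=> fM; elim: w => [|[[] []] w IH].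
- by rewrite /word_eval !big_nil group_hom1.
all: by rewrite !word_eval_cons fM IH /word_eval_letter /= ?group_homV.
Qed.

(** Represent each element of the ball by a word of length at most [c * n] and evaluate that word in
    [D]. Multiplicativity and injectivity amount to the triviality of words for [g h (gh)^-1] and
    [g h^-1], whence the factor 3. *)
Lemma local_embedding_of_words (G D : groupType) (S : set G) (a b : G) (x t : D)
    (c n : nat) :
  (forall s, S s -> word_ball [set a; b] c s) ->
  (forall w : word, (size w <= 3 * (c * n))%N ->
    word_eval a b w = 1%g <-> word_eval x t w = 1%g) ->
  exists pi : G -> D, local_embedding (word_ball S n) pi.
Proof.
move=> ScB same.
have wP g : exists w : word,
    word_ball S n g -> (size w <= c * n)%N /\ g = word_eval a b w.
  (* Outside the ball the empty word is a mere default. *)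
  have [Bg|nBg] := pselect (word_ball S n g); last by exists [::].
  have /word_ballE[w sw gw] := word_ball_sub ScB Bg.
  by exists w.
have [W WP] := choice wP.
exists (fun g => word_eval x t (W g)); split=> [g h Bg Bh Bgh|g h].
  have [sg gE] := WP _ Bg; have [sh hE] := WP _ Bh; have [sgh ghE] := WP _ Bgh.
  apply/esym/divg1_eq; rewrite -word_eval_inv -!word_eval_cat; apply/same.
    by rewrite !size_cat /word_inv size_rev size_map; lia.
  by rewrite !word_eval_cat word_eval_inv -gE -hE -ghE mulgV.
rewrite !in_setE => Bg Bh.
have [sg gE] := WP _ Bg; have [sh hE] := WP _ Bh => e.
apply/divg1_eq; rewrite gE hE -word_eval_inv -!word_eval_cat; apply/same.
  by rewrite !size_cat /word_inv size_rev size_map; lia.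
by rewrite !word_eval_cat word_eval_inv e mulgV.
Qed.

(** * Subgroups spanned by two elements *)

Section Span2.
Variables (G : groupType) (a b : G).

Lemma spanned_left : spanned [set a; b] a.
Proof. by apply/asboolP; exists 1%N; apply: word_ball_gen; left. Qed.

Lemma spanned_right : spanned [set a; b] b.
Proof. by apply/asboolP; exists 1%N; apply: word_ball_gen; right. Qed.

Definition span_left : span_group [set a; b] := Sub a spanned_left.
Definition span_right : span_group [set a; b] := Sub b spanned_right.

Lemma val_group_hom : group_hom (\val : span_group [set a; b] -> G).
Proof. by move=> x y; exact: valM. Qed.

Lemma val_eval w : \val (word_eval span_left span_right w) = word_eval a b w.
Proof. by rewrite (word_eval_hom _ _ _ val_group_hom) !SubK. Qed.

Lemma span_generated : generated_by [set span_left; span_right].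
Proof.
move=> g; have /asboolP[n /word_ballE[w sw gw]] := valP g.
exists n; apply/word_ballE; exists w => //; apply/val_inj.
by rewrite val_eval.
Qed.

End Span2.

(** * Integer invariants of words and their bounds *)

Definition sign (e : bool) : int := if e then -1 else 1.

Fixpoint drift (w : word) : int :=
  match w with
  | [::] => 0
  | (b, e) :: w' => (if b then 0 else sign e) + drift w'
  end.

(* Signed number of occurrences of [lamp] at a position congruent to [r]
   modulo [N], an actual equality when [N = 0]. *)
Fixpoint count_at (N : nat) (r : int) (w : word) : int :=
  match w with
  | [::] => 0
  | (true, e) :: w' => sign e * (N %| r)%Z%:R + count_at N r w'
  | (false, e) :: w' => count_at N (r - sign e) w'
  end.

(* Signed number of pairs of occurrences of [lamp], the second one lying [h]
   steps after the first one modulo [N]. *)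
Fixpoint pair_count (N h : nat) (w : word) : int :=
  match w with
  | [::] => 0
  | (b, e) :: w' =>
    (if b then sign e * count_at N h%:Z w' else 0) + pair_count N h w'
  end.

Lemma norm_sign e : `|sign e| = 1.
Proof. by case: e; rewrite /sign ?normrN normr1. Qed.

Lemma drift_le w : `|drift w| <= (size w)%:Z.
Proof.
elim: w => [|[b e] w IH] //=.
rewrite -addn1 PoszD addrC; apply: (le_trans (ler_normD _ _)).
by rewrite lerD //; case: b; rewrite ?normr0 ?norm_sign.
Qed.

Lemma count_at_le N r w : `|count_at N r w| <= (size w)%:Z.
Proof.
elim: w r => [|[[] e] w IH] r //=.
  rewrite -addn1 PoszD addrC; apply: (le_trans (ler_normD _ _)).
  by rewrite lerD // normrM norm_sign mul1r; case: (_ %| _)%Z.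
by apply: (le_trans (IH _)); rewrite lez_nat.
Qed.

Lemma pair_count_le N h w : `|pair_count N h w| <= (size w ^ 2)%:Z.
Proof.
elim: w => [|[b e] w IH] //=.
apply: (le_trans (ler_normD _ _)).
have: `|if b then sign e * count_at N h w else 0| <= (size w)%:Z.
  by case: b; rewrite ?normr0 // normrM norm_sign mul1r count_at_le.
move: IH; set u := `|_|; set v := `|_|; move: (size w) => s.
by rewrite -!mulnn; nia.
Qed.

(** While the word is read, the tracked position stays smaller than both moduli in absolute value,
    so each divisibility test is a test for zero. *)
Lemma count_at_congr N1 N2 r w :
  (`|r| + size w < N1)%N -> (`|r| + size w < N2)%N ->
  count_at N1 r w = count_at N2 r w.
Proof.
elim: w r => [|[[] e] w IH] r //= lt1 lt2; last first.
  by apply: IH; case: e; rewrite /sign; lia.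
rewrite (IH r); [|lia|lia]; congr (_ * _%:R + _).
suff H N : (`|r| + (size w).+1 < N)%N -> (N %| r)%Z = (r == 0) by rewrite !H.
move=> lt; rewrite dvdzE /=; case: (eqVneq r 0) => [->|r0]; first exact: dvdn0.
by apply/negP => /dvdn_leq; lia.
Qed.

(** A word only reaches positions bounded by its length, and none of these is congruent to [r]. *)
Lemma count_at_far (N : nat) r w :
  (forall a : int, (`|a| <= size w)%N -> ~~ (N %| r - a)%Z) ->
  count_at N r w = 0.
Proof.
elim: w r => [|[[] e] w IH] r //= far; last first.
  apply: IH => a aw; rewrite -addrA -opprD; apply: far.
  by case: e; rewrite /sign; lia.
rewrite IH => [|a aw]; last by apply: far; lia.
by have := far 0 isT; rewrite subr0 => /negPf ->; rewrite mulr0.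
Qed.

Lemma count_at_mod (N : nat) r r' w :
  (N %| r - r')%Z -> count_at N r w = count_at N r' w.
Proof.
elim: w r r' => [|[[] e] w IH] r r' //= rr'; last first.
  by apply: IH; rewrite opprB addrA subrK.
rewrite (IH r r') //; congr (_ * _%:R + _).
by rewrite -[r in LHS](subrK r') rpredDl.
Qed.

(** The offset [a] between two lamps is at most the length of the word, so [h - a] lies strictly
    between 0 and [N]. *)
Lemma pair_count_far N h w : (size w < h)%N -> (size w < N - h)%N ->
  pair_count N h w = 0.
Proof.
elim: w => [|[b e] w IH] //= lt1 lt2.
rewrite IH ?addr0; [|lia|lia]; case: b => //.
rewrite count_at_far ?mulr0 // => a aw; rewrite dvdzE /=.
by apply/negP => /dvdn_leq; lia.
Qed.

(** * Triviality of a word over a finite cycle as a system of congruences *)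

Section CyclicLevel.
Variables (N h q : nat).
Hypotheses (N_gt1 : (1 < N)%N) (q_gt1 : (1 < q)%N).

Definition cyclic_level : finGroupType := twisted 'Z_q (h%:R : 'Z_N).

Definition cyclic_lamp : twisted 'Z_q (h%:R : 'Z_N) := lamp 'Z_q (h%:R : 'Z_N).
Definition cyclic_step : twisted 'Z_q (h%:R : 'Z_N) := step 'Z_q (h%:R : 'Z_N).

Lemma card_cyclic_level : #|cyclic_level| = (N * q ^ N * q)%N.
Proof.
by rewrite /= !card_prod card_ffun !card_ord !Zp_cast.
Qed.

Lemma intr_Zp_eq0 (n : nat) (k : int) : (1 < n)%N ->
  (k%:~R == 0 :> 'Z_n) = (n %| k)%Z.
Proof.
move=> n_gt1; have natE (m : nat) : (m%:R == 0 :> 'Z_n) = (n %| m)%N.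
  by rewrite -val_eqE /= val_Zp_nat.
case: k => m; first by rewrite -pmulrn natE.
by rewrite NegzE mulrNz oppr_eq0 -pmulrn natE dvdzE.
Qed.


Notation leval := (word_eval cyclic_lamp cyclic_step).

Lemma height_eval w : height (leval w) = (drift w)%:~R :> 'Z_N.
Proof.
elim: w => [|[[] e] w IH]; first by rewrite /word_eval big_nil.
  rewrite word_eval_cons heightM IH.
  by case: e; rewrite /word_eval_letter /= ?heightV /= ?oppr0 !add0r.
by rewrite word_eval_cons heightM IH; case: e; rewrite /= intrD.
Qed.

Lemma lights_eval w (r : int) :
  lights (leval w) (r%:~R : 'Z_N) = (count_at N r w)%:~R :> 'Z_q.
Proof.
elim: w r => [|[[] e] w IH] r; first by rewrite /word_eval big_nil ffunE.
  rewrite word_eval_cons lightsM /= intrD -IH -(intr_Zp_eq0 r N_gt1).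
  rewrite intrM [X in _ * X + _]rmorph_nat.
  case: e; rewrite /word_eval_letter /= ?heightV ?lightsV /= ?oppr0 ?shift0
    !ffunE.
    by rewrite rmorphN1 mulN1r.
  by rewrite mul1r.
rewrite word_eval_cons lightsM /=; rewrite -IH.
by case: e; rewrite /word_eval_letter /= ?heightV ?lightsV /= !ffunE ?oppr0
  ?add0r rmorphB.
Qed.

Hypothesis N_ndvd_h : ~~ (N %| h)%N.

(** A lamp put in front sits at position 0, and the cocycle pairs it with the later lamps at
    position [h], just as [pair_count] does. *)
Lemma central_eval w : central (leval w) = (pair_count N h w)%:~R :> 'Z_q.
Proof.
have pairing_lamp u : pairing (h%:R : 'Z_N) (lights cyclic_lamp) u = u h%:~R.
  by rewrite pairing_delta add0r pmulrn.
have h_neq0 : (h%:~R == 0 :> 'Z_N) = false.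
  by rewrite intr_Zp_eq0 // dvdzE; exact: negPf.
have pairing_lampV u :
    pairing (h%:R : 'Z_N) (lights cyclic_lamp^-1%g) u = - u h%:~R.
  by rewrite lightsV /= oppr0 shift0 pairingNl pairing_lamp.
(* A lamp does not pair with itself because [N] does not divide [h]; hence inverting it creates no
   central term. *)
have central_lampV : central cyclic_lamp^-1%g = 0.
  by rewrite centralV pairing_lamp oppr0 add0r ffunE h_neq0.
elim: w => [|[[] e] w IH]; first by rewrite /word_eval big_nil.
  rewrite word_eval_cons centralM [pair_count _ _ _]/= intrD -IH.
  rewrite intrM -lights_eval.
  rewrite {1 2 3}/word_eval_letter; case: e.
    rewrite [(true, true).1]/= [(true, true).2]/= central_lampV pairing_lampV.
    by rewrite heightV /= oppr0 shift0; ring.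
  by rewrite pairing_lamp shift0 /=; ring.
rewrite word_eval_cons centralM /= add0r -IH.
by case: e; rewrite /word_eval_letter /= ?lightsV /= ?shift_zero ?oppr0
  !pairing0l ?oppr0 !(addr0, add0r).
Qed.

Lemma cyclic_level_eval_eq1 w : leval w = 1%g <->
  [/\ (N %| drift w)%Z, forall r, (q %| count_at N r w)%Z
    & (q %| pair_count N h w)%Z].
Proof.
rewrite twisted_eq1 height_eval central_eval -!(intr_Zp_eq0 _ _) //.
split=> -[d l c]; split; try exact/eqP.
  by move=> r; rewrite -intr_Zp_eq0 // -lights_eval l ffunE.
apply/ffunP => r; rewrite ffunE.
have -> : r = (r : nat)%:~R :> 'Z_N by rewrite -pmulrn natr_Zp.
rewrite lights_eval.
by apply/eqP; rewrite intr_Zp_eq0.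
Qed.

End CyclicLevel.

(** * Commutators of lamps *)

Section Commutator.
Variables (A : finNzRingType) (K : finComNzRingType) (h : A).
Implicit Types f g : twisted K h.

Lemma twisted_commg f g : height f = 0 -> height g = 0 ->
  [~ f, g]%g = (0, 0, pairing h (lights f) (lights g)
                      - pairing h (lights g) (lights f)) :> twisted K h.
Proof.
case: f g => -[s u] x [[t v] y]; rewrite /height /lights /= => -> ->.
(* Multiplying by [g * f] turns the claim into a comparison of [f * g] with a product, without
   inverses. *)
apply: (@mulgI _ (((0, v, y) : twisted K h) * ((0, u, x) : twisted K h))%g).
rewrite -commgC; congr (_, _, _) => /=.
  by rewrite !addr0.
  by rewrite !shift0 shift_zero addr0 addrC.
by rewrite addr0 !shift0 pairing0r; ring.
Qed.

Lemma step_expg n : (step K h ^+ n)%g = (n%:R, 0, 0) :> twisted K h.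
Proof.
elim: n => [|n IH]; first by rewrite expg0.
rewrite expgS IH; congr (_, _, _); rewrite /= ?shift_zero ?pairing0l ?addr0 //.
by rewrite -natr1 addrC.
Qed.

Lemma lamp_conj n :
  (step K h ^+ n * lamp K h * step K h ^- n)%g = (0, delta K n%:R, 0)
    :> twisted K h.
Proof.
rewrite step_expg; congr (_, _, _) => /=.
- by rewrite addr0 subrr.
- rewrite !shift_zero ?(shift_opp, shift_zero, oppr0, addr0, add0r).
  by apply/ffunP => a; rewrite !ffunE subr_eq0.
- by rewrite !(shift_zero, oppr0, pairing0l, pairing0r, addr0).
Qed.

Definition lamp_commutator n : twisted K h :=
  [~ lamp K h, step K h ^+ n * lamp K h * step K h ^- n]%g.

(** The two indicators are the pairings of the two lamps in either order. *)
Lemma lamp_commutatorE n : lamp_commutator n =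
  (0, 0, (h == n%:R)%:R - (n%:R + h == 0)%:R) :> twisted K h.
Proof.
rewrite /lamp_commutator lamp_conj twisted_commg // !pairing_delta !ffunE.
by rewrite add0r.
Qed.

Lemma central_expg (z : K) n :
  (((0, 0, z) : twisted K h) ^+ n)%g = (0, 0, z *+ n) :> twisted K h.
Proof.
elim: n => [|n IH]; first by rewrite expg0.
rewrite expgS IH; congr (_, _, _); rewrite /= ?shift_zero ?pairing0l ?addr0 //.
by rewrite mulrS.
Qed.

End Commutator.

(** * The levels, and the truncation of their moduli and of their number *)

(** The ratio 4 between cycle and offset keeps [4 ^ i] and its opposite distinct on the cycle, and
    the offsets of all other levels different from both. *)
Definition level (i q : nat) : finGroupType :=
  cyclic_level (4 ^ i.+1) (4 ^ i) q.
Definition level_lamp i q : level i q := cyclic_lamp (4 ^ i.+1) (4 ^ i) q.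
Definition level_step i q : level i q := cyclic_step (4 ^ i.+1) (4 ^ i) q.

Lemma level_eval_eq1 i q w : (1 < q)%N ->
  word_eval (level_lamp i q) (level_step i q) w = 1%g <->
  [/\ ((4 ^ i.+1)%N %| drift w)%Z,
      forall r, (q %| count_at (4 ^ i.+1) r w)%Z
    & (q %| pair_count (4 ^ i.+1) (4 ^ i) w)%Z].
Proof.
move=> q_gt1; apply: cyclic_level_eval_eq1 => //.
  by rewrite -{1}(expn0 4) ltn_exp2l.
by rewrite dvdn_Pexp2l // ltnn.
Qed.

(** If the minimum is not [p], both moduli exceed [|v|] and divide it only when it is zero. *)
Lemma dvdz_minn (p k : nat) (v : int) : `|v| < k%:Z ->
  (minn p k %| v)%Z = (p %| v)%Z.
Proof.
move=> vk; rewrite !dvdzE /=; case: leqP => // kp.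
have [->|v0] := eqVneq v 0; first by rewrite !dvdn0.
by rewrite !gtnNdvd //; lia.
Qed.

Lemma dvdz_small (p : nat) (v : int) : (p %| v)%Z -> `|v| < p%:Z -> v = 0.
Proof.
rewrite dvdzE => pv vp; apply/eqP; rewrite -absz_eq0; apply/eqP.
by apply/eqP; rewrite eqn0Ngt; apply/negP => /dvdn_leq/(_ pv); lia.
Qed.

Lemma expn4_gt m : (m < 4 ^ m)%N.
Proof. exact: ltn_expl. Qed.

(** Up to coordinate [m], the sizes of the counts allow [dvdz_minn]. Triviality in coordinate [m]
    forces the drift and all lamp counts to vanish as integers; beyond [m] the word is too short to
    wrap around the cycle or to contain lamps at the critical distance, so nothing new is
    required. *)
Lemma levels_truncate (p : nat -> nat) (m : nat) (w : word) :
  (forall i, (1 < p i)%N) -> (4 ^ m <= p m)%N -> (size w <= m)%N ->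
  (forall i, word_eval (level_lamp i (p i)) (level_step i (p i)) w = 1%g) <->
  (forall i, (i <= m)%N ->
    let q := minn (p i) (m ^ 2 + 2) in
    word_eval (level_lamp i q) (level_step i q) w = 1%g).
Proof.
move=> p_gt1 pm wm.
(* The [+ 2] keeps the modulus above 1 even for [m = 0]. *)
have q_gt1 i : (1 < minn (p i) (m ^ 2 + 2))%N by rewrite leq_min p_gt1; lia.
have m4 := expn4_gt m.
have cntK N r : `|count_at N r w| < (m ^ 2 + 2)%N%:Z.
  by apply: (le_lt_trans (count_at_le _ _ _)); nia.
have prK N h : `|pair_count N h w| < (m ^ 2 + 2)%N%:Z.
  by apply: (le_lt_trans (pair_count_le _ _ _)); nia.
split=> triv i.
  move=> im; have /level_eval_eq1[//|d c pr] := triv i.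
  by apply/level_eval_eq1 => //; split=> [//|r|]; rewrite dvdz_minn.
have [im|mi] := leqP i m.
  have /level_eval_eq1[//|d c pr] := triv i im.
  apply/level_eval_eq1 => //.
  by split=> [//|r|]; rewrite -(dvdz_minn _ (cntK _ _), dvdz_minn _ (prK _ _)).
have /level_eval_eq1[//|d c pr] := triv m (leqnn m).
have d0 : drift w = 0.
  apply: (dvdz_small d); apply: (le_lt_trans (drift_le w)).
  by rewrite expnS; lia.
(* By [4 ^ m <= p m], the modulus in coordinate [m] exceeds the length of the word. *)
have c0 r : count_at (4 ^ m.+1) r w = 0.
  by apply: (dvdz_small (c r)); apply: (le_lt_trans (count_at_le _ _ _)); nia.
have m4i : (4 ^ m < 4 ^ i)%N by rewrite ltn_exp2l.
apply/level_eval_eq1 => //.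
rewrite d0 dvdz0 pair_count_far ?dvdz0 //; first last.
- by rewrite expnS; lia.
- by lia.
split=> // r; suff -> : count_at (4 ^ i.+1) r w = 0 by rewrite dvdz0.
(* Either [r] is congruent to a position [a] within reach, where the two cycles give the same count,
   or nothing is counted at [r]. *)
have [[a [am ra]]|far] := pselect (exists a : int,
    (`|a| <= size w)%N /\ ((4 ^ i.+1)%N %| r - a)%Z).
  rewrite (count_at_mod w ra) (@count_at_congr _ (4 ^ m.+1)) //.
    by rewrite expnS; lia.
  by rewrite expnS; lia.
by apply: count_at_far => a aw; apply/negP => ra; apply: far; exists a.
Qed.

(** * Finite models of bounded order *)

Lemma finite_product (X : nat -> finGroupType) (x t : forall i, X i) (k : nat) :
  exists (Q : finGroupType) (a b : Q), #|Q| = (\prod_(i < k.+1) #|X i|)%N /\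
    forall w, word_eval a b w = 1%g <->
      forall i, (i <= k)%N -> word_eval (x i) (t i) w = 1%g.
Proof.
elim: k => [|k [Q [a [b [cardQ QP]]]]].
  exists (X 0), (x 0), (t 0); split; first by rewrite big_ord1.
  by move=> w; split=> [e [|]//|]; apply.
exists (Q * X k.+1)%type, (a, x k.+1), (b, t k.+1); split.
  by rewrite big_ord_recr /= -cardQ card_prod.
move=> w; have -> : word_eval (G := (Q * X k.+1)%type) (a, x k.+1) (b, t k.+1) w
    = (word_eval a b w, word_eval (x k.+1) (t k.+1) w).
  rewrite [LHS]surjective_pairing; congr (_, _).
    exact: (@word_eval_hom (Q * X k.+1)%type Q fst).
  exact: (@word_eval_hom (Q * X k.+1)%type (X k.+1) snd).
split=> [[e1 e2] i|e].
  rewrite leq_eqVlt => /predU1P[->//|]; rewrite ltnS.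
  exact: (QP w).1.
congr (_, _); last exact: e.
by apply/QP => i ik; apply: e; exact: leqW.
Qed.

(** The order is [N * q ^ N * q] with [N <= 4 ^ m.+1] and [q <= 2 ^ (2 * m + 2)]; the term
    [4 * m + 5] is [1 + (2 * m + 2) + (2 * m + 2)]. *)
Lemma card_level_le i m q : (i <= m)%N -> (1 < q)%N -> (q <= m ^ 2 + 2)%N ->
  (#|level i q| <= 2 ^ (4 ^ m.+1 * (4 * m + 5)))%N.
Proof.
move=> im q_gt1 qm; rewrite card_cyclic_level //; last first.
  by rewrite -{1}(expn0 4) ltn_exp2l.
have Nm : (4 ^ i.+1 <= 4 ^ m.+1)%N by rewrite leq_exp2l.
have q2 : (q <= 2 ^ (2 * m + 2))%N.
  apply: (leq_trans qm); have : (m + 1 < 2 ^ (m + 1))%N by exact: ltn_expl.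
  have -> : (2 ^ (2 * m + 2) = (2 ^ (m + 1)) ^ 2)%N.
    by rewrite -expnM; congr expn; lia.
  by move: (2 ^ (m + 1))%N => e; rewrite -!mulnn; nia.
have N0 : (0 < 4 ^ m.+1)%N by rewrite expn_gt0.
apply: (@leq_trans (2 ^ (4 ^ m.+1) * (2 ^ (2 * m + 2)) ^ (4 ^ m.+1)
                    * 2 ^ (2 * m + 2)))%N.
  apply: leq_mul => //; apply: leq_mul.
    by apply: (leq_trans Nm); exact/ltnW/ltn_expl.
  apply: (@leq_trans ((2 ^ (2 * m + 2)) ^ (4 ^ i.+1)))%N.
    by rewrite leq_exp2r // expn_gt0.
  by rewrite leq_pexp2l // expn_gt0.
by rewrite -expnM -!expnD leq_exp2l //; nia.
Qed.

Lemma finite_model (p : nat -> nat) (m : nat) :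
  (forall i, (1 < p i)%N) -> (4 ^ m <= p m)%N -> (0 < m)%N ->
  exists (Q : finGroupType) (a b : Q), (#|Q| <= 2 ^ 2 ^ (9 * m))%N /\
    forall w : word, (size w <= m)%N -> word_eval a b w = 1%g <->
      forall i, word_eval (level_lamp i (p i)) (level_step i (p i)) w = 1%g.
Proof.
move=> p_gt1 pm m_gt0; pose q i := minn (p i) (m ^ 2 + 2).
have [Q [a [b [cardQ QP]]]] := finite_product
  (fun i => level_lamp i (q i)) (fun i => level_step i (q i)) m.
exists Q, a, b; split; last first.
  by move=> w wm; rewrite (levels_truncate p_gt1 pm wm); exact: QP.
rewrite cardQ.
apply: (@leq_trans (\prod_(i < m.+1) 2 ^ (4 ^ m.+1 * (4 * m + 5))))%N.
  apply: leq_prod => i _; apply: card_level_le; first by rewrite -ltnS.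
    by rewrite /q leq_min p_gt1; lia.
  by rewrite /q geq_minr.
rewrite prod_nat_const card_ord -expnM leq_exp2l //.
have m2 : (m < 2 ^ m)%N by exact: ltn_expl.
(* The three powers bound [4 ^ m.+1], [4 * m + 5] and [m.+1]. Their exponents add up to [4 * m + 5],
   at most [9 * m] as [m] is positive. *)
apply: (@leq_trans (2 ^ (2 * m.+1) * 2 ^ (m + 3) * 2 ^ m))%N; last first.
  by rewrite -!expnD leq_exp2l //; lia.
apply: leq_mul => //; rewrite expnM leq_mul //.
by rewrite expnD; lia.
Qed.

(** * Change of generators and evaluation of growth functions *)

Lemma finite_word_ball (G : groupType) (S T : set G) : finite_set S ->
  generated_by T -> exists c, forall x, S x -> word_ball T c x.
Proof.
move=> /finite_seqP[s ->] genT; elim: s => [|x s [c cP]].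
  by exists 0%N.
have [n nP] := genT x; exists (maxn c n) => y /=.
rewrite inE => /predU1P[->|ys].
  by apply: word_ball_le nP; exact: leq_maxr.
by apply: (@word_ball_le _ _ c); [exact: leq_maxl|exact: cP].
Qed.

Lemma eval_at_nat (R : realType) (f : nat -> \bar R) (c n : nat) :
  eval_at f (c%:R * n%:R) = f (c * n)%N.
Proof. by rewrite /eval_at -natrM pmulrn intrKceil. Qed.

Lemma natr_Zp_eq0 (n m : nat) : (1 < n)%N -> (m%:R == 0 :> 'Z_n) = (n %| m)%N.
Proof. by move=> n_gt1; rewrite pmulrn intr_Zp_eq0. Qed.

Definition double_exp (n : nat) : nat := (2 ^ 2 ^ n)%N.

(** * The group [Gamma] and its LEF growth *)

Section Gamma.
Variable p : nat -> nat.

Definition level_product := product_group (fun i => level i (p i)).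

Definition product_lamp : level_product := fun i => level_lamp i (p i).
Definition product_step : level_product := fun i => level_step i (p i).

Definition Gamma : groupType := span_group [set product_lamp; product_step].

Definition gamma_lamp : Gamma := span_left product_lamp product_step.
Definition gamma_step : Gamma := span_right product_lamp product_step.

Definition gamma_coord (i : nat) (g : Gamma) : level i (p i) := (\val g) i.

Lemma gamma_coordM i : group_hom (gamma_coord i).
Proof. by move=> x y; rewrite /gamma_coord (val_group_hom x y). Qed.

Lemma gamma_eqP (g k : Gamma) :
  g = k <-> forall i, gamma_coord i g = gamma_coord i k.
Proof.
split=> [->//|gk]; apply/val_inj/functional_extensionality_dep => i.
exact: gk.
Qed.

Lemma gamma_word_eval_eq1 w : word_eval gamma_lamp gamma_step w = 1%g <->
  forall i, word_eval (level_lamp i (p i)) (level_step i (p i)) w = 1%g.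
Proof.
split=> [e i|e].
  have := congr1 (gamma_coord i) e.
  rewrite (word_eval_hom _ _ _ (gamma_coordM i)).
  by rewrite (group_hom1 (gamma_coordM i)).
apply/gamma_eqP => i.
rewrite (word_eval_hom _ _ _ (gamma_coordM i)) (group_hom1 (gamma_coordM i)).
exact: e.
Qed.

Lemma gamma_two_generated : two_generated Gamma.
Proof. exists gamma_lamp, gamma_step; exact: span_generated. Qed.

Lemma gamma_residually_finite : residually_finite Gamma.
Proof.
move=> g g1; have [i gi] : exists i, gamma_coord i g <> 1%g.
  apply/existsNP => e; apply: g1; apply/gamma_eqP => i.
  by rewrite e (group_hom1 (gamma_coordM i)).
by exists (level i (p i)), (gamma_coord i); split=> //; exact: gamma_coordM.
Qed.

Lemma gamma_lef (R : realType) : (forall i, (1 < p i)%N) ->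
  (forall i, (4 ^ i <= p i)%N) ->
  lef_growth_preceq Gamma (of_natfun R double_exp).
Proof.
move=> p_gt1 p4 S finS _.
have [c cP] :=
  finite_word_ball finS (@span_generated _ product_lamp product_step).
(* The constant is 3 from [local_embedding_of_words] times 9 from [finite_model]; the successor
   keeps it positive. *)
exists (27 * c.+1)%N%:R; first by rewrite ltr0n.
move=> n n_gt0; rewrite eval_at_nat /of_natfun.
have m_gt0 : (0 < 3 * (c.+1 * n))%N by rewrite !muln_gt0.
have [Q [a [b [cardQ QP]]]] := finite_model p_gt1 (p4 _) m_gt0.
apply: (@le_trans _ _ (#|Q|%:R)%:E); last first.
  rewrite lee_fin ler_nat; apply: (leq_trans cardQ).
  by rewrite /double_exp !leq_exp2l //; lia.
apply: ereal_inf_lbound; exists #|Q| => //; exists Q; split=> //.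
apply: (@local_embedding_of_words _ _ S gamma_lamp gamma_step a b c.+1).
  by move=> s /cP; apply: word_ball_le.
by move=> w wm; rewrite gamma_word_eval_eq1 QP.
Qed.

(** * Short commutators of large prime order, and residual finiteness growth *)

Definition gamma_commutator (i : nat) : Gamma :=
  [~ gamma_lamp, gamma_step ^+ (4 ^ i) * gamma_lamp * gamma_step ^- (4 ^ i)]%g.

Lemma gamma_commutator_ball i :
  word_ball [set gamma_lamp; gamma_step] (4 * 4 ^ i + 4) (gamma_commutator i).
Proof.
set S := [set gamma_lamp; gamma_step]%classic; set h := (4 ^ i)%N.
have Blamp : word_ball S 1 gamma_lamp by apply: word_ball_gen; left.
have Bstep : word_ball S (h * 1) (gamma_step ^+ h)%g.
  by apply: word_ballX; apply: word_ball_gen; right.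
have Bconj : word_ball S (h * 1 + 1 + h * 1)
    (gamma_step ^+ h * gamma_lamp * gamma_step ^- h)%g.
  by apply: word_ballM; [exact: word_ballM|exact: word_ballV].
have -> : (4 * h + 4 =
    1 + ((h * 1 + 1 + h * 1) + (1 + (h * 1 + 1 + h * 1))))%N by lia.
apply: word_ballM; first exact: word_ballV.
apply: word_ballM; first exact: word_ballV.
exact: word_ballM.
Qed.

Lemma gamma_commutator_coord i j : gamma_coord j (gamma_commutator i) =
  (0, 0, ((4 ^ j)%:R == (4 ^ i)%:R :> 'Z_(4 ^ j.+1))%:R
       - ((4 ^ i)%:R + (4 ^ j)%:R == 0 :> 'Z_(4 ^ j.+1))%:R)
  :> twisted 'Z_(p j) ((4 ^ j)%:R : 'Z_(4 ^ j.+1)).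
Proof.
rewrite -lamp_commutatorE /gamma_commutator /lamp_commutator !commgEl !conjgE.
have cM := gamma_coordM j; have cV g := group_homV g cM.
by rewrite !(cM, cV, group_homX _ _ cM).
Qed.

(** For [i < j] both indicators vanish. For [i > j] the offset [4 ^ i] is zero on the cycle, so the
    indicators coincide: a lamp commutes with itself. *)
Lemma gamma_commutator_coord_neq i j : i != j ->
  gamma_coord j (gamma_commutator i) = 1%g.
Proof.
move=> ij; rewrite gamma_commutator_coord.
have N_gt1 : (1 < 4 ^ j.+1)%N by rewrite -{1}(expn0 4) ltn_exp2l.
case: (ltngtP i j) ij => // [ij|ji] _.
  have lt : (4 ^ i < 4 ^ j)%N by rewrite ltn_exp2l.
  have gt0 : (0 < 4 ^ i)%N by rewrite expn_gt0.
  rewrite -natrD natr_Zp_eq0 // gtnNdvd; [|lia|rewrite expnS; lia].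
  have -> : ((4 ^ j)%:R == (4 ^ i)%:R :> 'Z_(4 ^ j.+1)) = false.
    rewrite -subr_eq0 -natrB; last exact: ltnW.
    by rewrite natr_Zp_eq0 // gtnNdvd //; [lia|rewrite expnS; lia].
  by rewrite subrr.
have -> : (4 ^ i)%:R = 0 :> 'Z_(4 ^ j.+1).
  by apply/eqP; rewrite natr_Zp_eq0 // dvdn_exp2l.
by rewrite add0r subrr.
Qed.

(** Only the first indicator survives, as [2 * 4 ^ i] is not zero modulo [4 ^ i.+1]. *)
Lemma gamma_commutator_coord_eq i :
  gamma_coord i (gamma_commutator i) =
    (0, 0, 1) :> twisted 'Z_(p i) ((4 ^ i)%:R : 'Z_(4 ^ i.+1)).
Proof.
rewrite gamma_commutator_coord eqxx -natrD natr_Zp_eq0; last first.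
  by rewrite -{1}(expn0 4) ltn_exp2l.
have gt0 : (0 < 4 ^ i)%N by rewrite expn_gt0.
by rewrite gtnNdvd; [rewrite subr0|lia|rewrite expnS; lia].
Qed.

Lemma gamma_commutator_neq1 i : gamma_commutator i <> 1%g.
Proof.
move=> /(congr1 (gamma_coord i)).
by rewrite gamma_commutator_coord_eq (group_hom1 (gamma_coordM i)).
Qed.

Lemma gamma_commutator_expg i : (1 < p i)%N ->
  (gamma_commutator i ^+ p i)%g = 1%g.
Proof.
move=> p_gt1; apply/gamma_eqP => j.
rewrite (group_homX _ _ (gamma_coordM j)) (group_hom1 (gamma_coordM j)).
have [<-|ij] := eqVneq i j; last first.
  by rewrite gamma_commutator_coord_neq // expg1n.
rewrite gamma_commutator_coord_eq central_expg.
by congr (_, _, _); rewrite pchar_Zp.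
Qed.

(** The image of the commutator is nontrivial and killed by the prime [p i], so its order is exactly
    [p i]. *)
Lemma gamma_quotient_card i (F : finGroupType) (f : Gamma -> F) :
  prime (p i) -> group_hom f -> f (gamma_commutator i) <> 1%g ->
  (p i <= #|F|)%N.
Proof.
move=> p_pr fM f1; rewrite -(nt_prime_order p_pr _ (introN eqP f1)).
  exact: max_card.
rewrite -(group_homX _ _ fM) gamma_commutator_expg ?prime_gt1 //.
exact: group_hom1.
Qed.

Lemma gamma_rf (R : realType) (f : nat -> nat) : (forall i, prime (p i)) ->
  (forall i n, (n <= 4 ^ i.+1)%N -> (f n <= p i)%N) ->
  preceq_rf_growth (of_natfun R f) Gamma.
Proof.
move=> p_pr fp S finS genS.
have fin2 : finite_set [set gamma_lamp; gamma_step]%classic.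
  exact: finite_set2.
have [c cP] := finite_word_ball fin2 genS.
(* The commutator has length at most [4 * 4 ^ i + 4 <= 8 * 4 ^ i], and [i] will be chosen with
   [4 ^ i <= n < 4 ^ i.+1]. *)
exists (8 * c.+1)%N%:R; first by rewrite ltr0n.
move=> n n_gt0; rewrite eval_at_nat /of_natfun.
apply: le_ereal_inf_tmp => _ [_ [F [[g [gM ginj]] <-]] <-].
rewrite lee_fin ler_nat; pose i := trunc_log 4 n.
have /andP[in4 ni4] := trunc_log_bounds (isT : (1 < 4)%N) n_gt0.
apply: (leq_trans (fp i _ (ltnW ni4))).
apply: (gamma_quotient_card (p_pr i) gM) => g1.
apply: (@gamma_commutator_neq1 i); apply: ginj; rewrite ?in_setE.
- have : word_ball S (c * (4 * 4 ^ i + 4)) (gamma_commutator i).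
    exact: word_ball_sub cP (gamma_commutator_ball i).
  apply: word_ball_le; apply: (@leq_trans (8 * c.+1 * 4 ^ i)); last first.
    by rewrite leq_mul2l in4 orbT.
  have : (0 < 4 ^ i)%N by rewrite expn_gt0.
  by move: (4 ^ i)%N => h; nia.
- exact: word_ball1.
- by rewrite g1 (group_hom1 gM).
Qed.

End Gamma.

(** * Choice of the primes and conclusion *)

Lemma double_exp_expexp (R : realType) :
  preceq (of_natfun R double_exp) (@expexp R).
Proof.
exists 1 => // n _; rewrite -[1]/(1%:R) eval_at_nat mul1n lee_fin /double_exp.
have pow2 k : (2 ^ k)%:R <= expR k%:R :> R.
  rewrite natrX -[k%:R]mulr1 mulrC expRM_natr.
  rewrite lerXn2r ?nnegrE ?expR_ge0 ?ler0n //.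
  by apply: le_trans (expR_ge1Dx 1).
by apply: (le_trans (pow2 _)); rewrite ler_expR.
Qed.

(** Take a prime above [4 ^ i] plus a sum of values of [f]; the sum dominates each value without
    monotonicity of [f]. *)
Lemma large_primes (f : nat -> nat) : exists p : nat -> nat,
  [/\ forall i, prime (p i), forall i, (4 ^ i <= p i)%N
    & forall i n, (n <= 4 ^ i.+1)%N -> (f n <= p i)%N].
Proof.
pose b i := (4 ^ i + \sum_(n < (4 ^ i.+1).+1) f n)%N.
exists (fun i => s2val (prime_above (b i))).
split=> i; case: prime_above => //= q bq _.
  by rewrite ltnW // (leq_ltn_trans _ bq) // leq_addr.
move=> n ni; rewrite ltnW // (leq_ltn_trans _ bq) //.
by rewrite /b (bigD1 (Ordinal (ni : n < (4 ^ i.+1).+1)%N)) //=; lia.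
Qed.

Theorem theorem1p1 (R : realType) :
  exists (C : groupType -> Prop) (f0 : nat -> nat),
    (forall G : groupType, C G -> two_generated G /\ residually_finite G) /\
    pos_fun f0 /\
    (forall f : nat -> nat, pos_fun f ->
      exists B : groupType, C B /\ preceq_rf_growth (of_natfun R f) B) /\
    (forall G : groupType, C G -> lef_growth_preceq G (of_natfun R f0)) /\
    preceq (of_natfun R f0) (@expexp R).
Proof.
(* The class collects all groups with the required uniform properties; it remains to find in it a
   group of large growth for each [f]. *)
exists (fun G => [/\ two_generated G, residually_finite G
  & lef_growth_preceq G (of_natfun R double_exp)]), double_exp.
split=> [G [] //|]; split=> [n _|]; first by rewrite expn_gt0.
split=> [f _|]; last by split=> [G []|]; last exact: double_exp_expexp.
have [p [p_pr p4 fp]] := large_primes f.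
exists (Gamma p); split; last exact: gamma_rf.
split; [exact: gamma_two_generated|exact: gamma_residually_finite|].
by apply: gamma_lef => // i; exact: prime_gt1.
Qed.
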